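(* Let $V$ be a finite-dimensional diffeological vector space, let $g$ be a pseudo-metric on $V$, and let $V_1$ be the maximal isotropic subspace of $g$. Then $V_1$ splits off as a smooth direct summand of $V$.
   Context: A diffeological space is a set $X$ with a collection of maps (plots) $U\to X$, for $U$ open in $\mathbb{R}^n$, $n\in\mathbb{N}$, such that: constant maps are plots; the composition of a plot with an ordinary smooth map between open sets of Euclidean spaces is a plot; a map that is locally a plot is a plot. A map $f:X\to Y$ is smooth if $f\circ p$ is a plot of $Y$ for every plot $p$ of $X$. A diffeological vector space is a real vector space with a diffeology for which addition and scalar multiplication are smooth (products carry the product diffeology, $\mathbb{R}$ its standard diffeology). The diffeological dual $V^*$ is the vector space of all smooth linear maps $V\to\mathbb{R}$, with the functional diffeology. A diffeological pseudo-metric on a diffeological vector space $V$ of finite dimension $n$ is a smooth symmetric semi-positive definite bilinear form $g:V\times V\to\mathbb{R}$ whose maximal isotropic subspace (the subspace $\{v\in V: g(v,w)=0\ \forall w\in V\}$) has dimension exactly $n-\dim(V^* )$. A subspace of $V$ carries the subset diffeology (its plots are the plots of $V$ with image in it). A decomposition $V=V_1\oplus V_2$ into vector subspaces is smooth if the diffeology of $V$ coincides with the direct sum (product) diffeology obtained from the subset diffeologies on $V_1$ and $V_2$. A subspace $W\leqslant V$ splits off as a smooth direct summand (splits off smoothly) if there is a subspace $Z\leqslant V$ such that $V=W\oplus Z$ is a smooth decomposition. *)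

(* Defs.v *)
From HB Require Import structures.
From mathcomp Require Import all_boot all_order all_algebra.
From mathcomp Require Import all_classical all_reals all_analysis.

Set Implicit Arguments.
Unset Strict Implicit.
Unset Printing Implicit Defensive.

Import Order.TTheory GRing.Theory Num.Theory.
Import numFieldNormedType.Exports.

Local Open Scope classical_set_scope.
Local Open Scope ring_scope.

(* C^k on U: all iterated partial derivatives of order at most k exist and are
   continuous at the points of U. Only used for U open, so that the values of
   [f] outside of U do not matter. *)
Fixpoint Ck (R : realType) (n : nat) (W : normedModType R) (k : nat)
    (U : set 'rV[R]_n) (f : 'rV[R]_n -> W) : Prop :=
  (forall x, U x -> {for x, continuous f}) /\
  if k is k'.+1 then
    forall i : 'I_n, (forall x, U x -> derivable f x (delta_mx 0 i)) /\
      Ck k' U ('D_(delta_mx 0 i) f)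
  else True.

Definition Cinfty (R : realType) (n : nat) (W : normedModType R)
    (U : set 'rV[R]_n) (f : 'rV[R]_n -> W) : Prop :=
  forall k, Ck k U f.

(* A set of parametrizations U -> X, with U a subset of R^n. The map U -> X is
   represented by a total function, which only matters on U (see [plot_ext]). *)
Definition parametrizations (R : realType) (X : Type) : Type :=
  forall n : nat, set 'rV[R]_n -> ('rV[R]_n -> X) -> Prop.

Record is_diffeology (R : realType) (X : Type) (D : parametrizations R X) :
    Prop := IsDiffeology {
  plot_open : forall n (U : set 'rV[R]_n) p, D n U p -> open U;
  plot_ext : forall n (U : set 'rV[R]_n) p q,
    (forall x, U x -> p x = q x) -> D n U p -> D n U q;
  plot_cst : forall n (U : set 'rV[R]_n) (a : X), open U -> D n U (fun=> a);
  plot_comp : forall m n (W : set 'rV[R]_m) (U : set 'rV[R]_n) p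
      (F : 'rV[R]_m -> 'rV[R]_n),
    open W -> Cinfty W F -> (forall y, W y -> U (F y)) ->
    D n U p -> D m W (p \o F);
  plot_local : forall n (U : set 'rV[R]_n) p, open U ->
    (forall x, U x -> exists W, [/\ W x, W `<=` U & D n W p]) -> D n U p
}.

Definition smooth (R : realType) (X Y : Type) (D : parametrizations R X)
    (E : parametrizations R Y) (f : X -> Y) : Prop :=
  forall n (U : set 'rV[R]_n) p, D n U p -> E n U (f \o p).

Definition std_diff (R : realType) : parametrizations R R :=
  fun n U p => open U /\ @Cinfty R n R^o U p.

Definition prod_diff (R : realType) (X Y : Type) (D : parametrizations R X)
    (E : parametrizations R Y) : parametrizations R (X * Y) :=
  fun n U p => D n U (fst \o p) /\ E n U (snd \o p).

Record is_diffeological_vector_space (R : realType) (V : lmodType R)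
    (D : parametrizations R V) : Prop := IsDiffeologicalVectorSpace {
  dvs_diffeology : is_diffeology D;
  dvs_add : smooth (prod_diff D D) D (fun u => u.1 + u.2);
  dvs_scale : smooth (prod_diff (@std_diff R) D) D (fun u => u.1 *: u.2)
}.

Definition sub_diff (R : realType) (V : vectType R) (D : parametrizations R V)
    (W : {vspace V}) : parametrizations R (subvs_of W) :=
  fun n U p => D n U (vsval \o p).

(* The product of the subset diffeologies on V1 and V2, transported to V along
   the map (v1, v2) |-> v1 + v2. *)
Definition dsum_diff (R : realType) (V : vectType R) (D : parametrizations R V)
    (V1 V2 : {vspace V}) : parametrizations R V :=
  fun n U p => exists q : 'rV[R]_n -> subvs_of V1 * subvs_of V2,
    prod_diff (sub_diff D (W := V1)) (sub_diff D (W := V2)) U q /\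
    forall x, U x -> p x = vsval (q x).1 + vsval (q x).2.

Record smooth_decomposition (R : realType) (V : vectType R)
    (D : parametrizations R V) (V1 V2 : {vspace V}) : Prop :=
  SmoothDecomposition {
  sdec_full : (V1 + V2)%VS = fullv;
  sdec_direct : directv (V1 + V2);
  sdec_diff : forall n (U : set 'rV[R]_n) p,
    D n U p <-> dsum_diff D V1 V2 U p
}.

Definition splits_off_smoothly (R : realType) (V : vectType R)
    (D : parametrizations R V) (W : {vspace V}) : Prop :=
  exists Z : {vspace V}, smooth_decomposition D W Z.

Section Ck_linear.
Variables (R : realType) (n : nat) (W : normedModType R) (U : set 'rV[R]_n).
Hypothesis oU : open U.
Implicit Types f g : 'rV[R]_n -> W.

Lemma eqon_near f g x : (forall y, U y -> f y = g y) -> U x ->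
  \near x, f x = g x.
Proof.
by move=> fg Ux; apply: filterS (open_nbhs_nbhs (conj oU Ux)).
Qed.

Lemma Ck_ext k f g : (forall x, U x -> f x = g x) -> Ck k U f -> Ck k U g.
Proof.
elim: k f g => [|k IH] f g fg /= [cf df]; split => //.
- move=> x Ux; have := cf _ Ux; rewrite /prop_for /continuous_at -(fg x Ux).
  apply: cvg_trans; apply: near_eq_cvg; first exact: (nbhs_filter x).
  exact: (eqon_near fg Ux).
- move=> x Ux; have := cf _ Ux; rewrite /prop_for /continuous_at -(fg x Ux).
  apply: cvg_trans; apply: near_eq_cvg; first exact: (nbhs_filter x).
  exact: (eqon_near fg Ux).
- move=> i; have [dfi Cfi] := df i; split.
    by move=> x Ux; apply: near_eq_derivable (dfi x Ux); exact: (eqon_near fg Ux).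
  by apply: IH Cfi => x Ux; apply: near_eq_derive; exact: (eqon_near fg Ux).
Qed.

Lemma Ck_cst k (c : W) : Ck k U (fun=> c).
Proof.
elim: k c => [|k IH] c /=; split => //; do ?by move=> x _; exact: cst_continuous.
move=> i; split=> [x _|]; first exact: derivable_cst.
by apply: Ck_ext (IH 0) => x _; rewrite derive_cst.
Qed.

Lemma Ck_linear k (a : R) f g :
  Ck k U f -> Ck k U g -> Ck k U (fun x => a *: f x + g x).
Proof.
elim: k f g => [|k IH] f g /= [cf df] [cg dg]; split => //.
- move=> x Ux; apply: cvgD (cg _ Ux); apply: cvgZl_tmp; exact: cf.
- move=> x Ux; apply: cvgD (cg _ Ux); apply: cvgZl_tmp; exact: cf.
- move=> i; have [dfi Cfi] := df i; have [dgi Cgi] := dg i; split.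
    by move=> x Ux; apply: derivableD (dgi _ Ux); apply: derivableZ; exact: dfi.
  apply: Ck_ext (IH _ _ Cfi Cgi) => x Ux.
  rewrite deriveD ?deriveZ//; [exact: dfi|by apply: derivableZ; exact: dfi|].
  exact: dgi.
Qed.
End Ck_linear.

Lemma vspace_of_pred (K : fieldType) (vT : vectType K) (P : vT -> Prop) :
  P 0 -> (forall a u v, P u -> P v -> P (a *: u + v)) ->
  exists U : {vspace vT}, forall v, (v \in U) <-> P v.
Proof.
move=> P0 PD.
suff H : forall d (U : {vspace vT}), (\dim {:vT} - \dim U <= d)%N ->
    (forall v, v \in U -> P v) ->
    exists U' : {vspace vT}, forall v, (v \in U') <-> P v.
  by apply: (H _ 0%VS (leqnn _)) => v; rewrite memv0 => /eqP->.
elim=> [|d IH] U dU UP.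
  exists U => v; split=> [/UP//|_].
  suff -> : U = fullv by rewrite memvf.
  by apply/eqP; rewrite eqEdim subvf/= -subn_eq0 -leqn0.
have [[v [Pv vU]]|nex] := pselect (exists v, P v /\ v \notin U); last first.
  exists U => v; split=> [/UP//|Pv].
  by apply: contrapT => vU; apply: nex; exists v; split=> //; apply/negP.
apply: (IH (<[v]> + U)%VS).
  rewrite dimv_disjoint_sum.
    have v0 : v != 0 by apply: contraNneq vU => ->; exact: mem0v.
    by rewrite dim_vline v0 add1n subnS; move: dU; case: (_ - _)%N.
  apply/eqP; rewrite -subv0; apply/subvP => w /memv_capP[/vlineP[c ->] cvU].
  rewrite memv0; apply: contraNT vU; rewrite scaler_eq0 negb_or => /andP[c0 _].
  by rewrite -[v](scalerK c0) memvZ.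
by move=> _ /memv_addP[_ /vlineP[c ->] [w wU ->]]; apply: PD => //; exact: UP.
Qed.

Lemma dual_exists (R : realType) (V : vectType R) (D : parametrizations R V) :
  is_diffeology D ->
  exists U : {vspace 'Hom(V, R^o)},
    forall f, (f \in U) <-> smooth D (@std_diff R) f.
Proof.
move=> DD; apply: vspace_of_pred => [n U p /(plot_open DD) oU|a f g sf sg n U p Dp].
  split=> // k; apply: (Ck_ext oU (f := fun=> 0)); last exact: Ck_cst.
  by move=> x _ /=; rewrite lfunE.
have [oU Cf] := sf _ _ _ Dp; have [_ Cg] := sg _ _ _ Dp; split=> // k.
apply: (Ck_ext oU (f := fun x => a *: (f (p x) : R^o) + g (p x))).
  by move=> x _ /=; rewrite add_lfunE scale_lfunE.
by apply: Ck_linear; [exact: oU|exact: Cf|exact: Cg].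
Qed.

(* The underlying vector space of the diffeological dual: by [mem_ddual] below,
   it consists of the smooth linear maps V -> R. *)
Definition ddual (R : realType) (V : vectType R) (D : parametrizations R V) :
    {vspace 'Hom(V, R^o)} :=
  xget 0%VS [set U : {vspace 'Hom(V, R^o)} |
    forall f, (f \in U) <-> smooth D (@std_diff R) f].

Lemma mem_ddual (R : realType) (V : vectType R) (D : parametrizations R V) :
  is_diffeology D ->
  forall f : 'Hom(V, R^o), (f \in ddual D) <-> smooth D (@std_diff R) f.
Proof.
move=> /dual_exists[U HU].
exact: (@xgetPex _ 0%VS
  [set U : {vspace 'Hom(V, R^o)} |
    forall f, (f \in U) <-> smooth D (@std_diff R) f] (ex_intro _ U HU)).
Qed.

Definition max_isotropic (R : realType) (V : vectType R) (g : {symmetric V}) :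
  {vspace V} := orthov g fullv.

Lemma max_isotropicP (R : realType) (V : vectType R) (g : {symmetric V}) v :
  (v \in max_isotropic g) <-> (forall w, g v w = 0).
Proof.
split=> [/mem_orthovP gv w|gv]; first by apply: gv; exact: memvf.
by apply/mem_orthovP => w _; exact: gv.
Qed.

Record is_pseudo_metric (R : realType) (V : vectType R)
    (D : parametrizations R V) (g : {symmetric V}) : Prop := IsPseudoMetric {
  pm_smooth : smooth (prod_diff D D) (@std_diff R) (fun u => g u.1 u.2);
  pm_ge0 : forall v, 0 <= g v v;
  pm_dim : \dim (max_isotropic g) = (\dim {:V} - \dim (ddual D))%N
}.

(* Main.v *)
Require Import Defs.
From mathcomp Require Import all_boot all_order all_algebra.
From mathcomp Require Import all_classical all_reals all_analysis.

(** Let [Z] be any algebraic complement of the radical [V1] of [g]. Then [g] is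
    nondegenerate on [Z], so the projection of [V] onto [Z] along [V1] is
    [v |-> \sum_i g(v, w_i) e_i] for a basis [e] of [Z] and its [g]-dual basis
    [w]. Each coefficient [g(-, w_i)] is smooth because [g] is, hence so are this
    projection and the complementary one, which is smoothness of the
    decomposition. *)

Import GRing.Theory numFieldNormedType.Exports.
Local Open Scope ring_scope.

Lemma symmC (F : fieldType) (V : vectType F) (g : {symmetric V}) (u v : V) :
  g u v = g v u.
Proof. by rewrite hermC expr0 mul1r. Qed.

(** A row [c] killed by the Gram matrix is the coordinate row of some [z] in [Z] that is
    [g]-orthogonal to every basis vector of [Z]. The hypothesis forces [z = 0], and freeness of the
    basis gives [c = 0]. *)
Lemma gram_unitmx (F : fieldType) (V : vectType F) (g : {symmetric V})
    (Z : {vspace V}) :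
  (orthov g Z :&: Z = 0)%VS ->
  (\matrix_(i < \dim Z, j < \dim Z) g (vbasis Z)`_i (vbasis Z)`_j) \in unitmx.
Proof.
move=> ZZ0; rewrite -row_free_unit -kermx_eq0; apply/rowV0P => c /sub_kermxP cG0.
set z := \sum_(i < \dim Z) c 0 i *: (vbasis Z)`_i.
have zZ : z \in Z.
  by apply: memv_suml => i _; rewrite memvZ// vbasis_mem// mem_nth ?size_tuple.
have z0 : z = 0.
  apply/eqP; rewrite -memv0 -ZZ0 memv_cap zZ andbT.
  apply/mem_orthovP => v /coord_vbasis ->.
  rewrite linear_sumr big1// => j _; rewrite linearZr/= /z linear_sumlz.
  move/matrixP: cG0 => /(_ 0 j); rewrite !mxE => cGj.
  rewrite (eq_bigr (fun i => c 0 i * (\matrix_(i, j) g (vbasis Z)`_i (vbasis Z)`_j) i j)).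
    by rewrite cGj mulr0.
  by move=> i _; rewrite linearZl_LR mxE.
apply/rowP => i; rewrite mxE.
by have /freeP/(_ (c 0) z0 i) := basis_free (vbasisP Z).
Qed.

(** The [g]-dual basis is read off the columns of the inverse Gram matrix. As [v] ranges over all of
    [V], the subtracted sum is its [g]-orthogonal projection onto [Z]. *)
Lemma dual_basis_exists (F : fieldType) (V : vectType F) (g : {symmetric V})
    (Z : {vspace V}) :
  (orthov g Z :&: Z = 0)%VS ->
  exists w : 'I_(\dim Z) -> V, forall v,
    v - \sum_i g v (w i) *: (vbasis Z)`_i \in orthov g Z.
Proof.
move=> /gram_unitmx; set G := (\matrix_(i, j) _) => uG.
exists (fun i => \sum_j invmx G j i *: (vbasis Z)`_j) => v.
apply/mem_orthovP => u /coord_vbasis ->; rewrite linear_sumr big1// => k _.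
rewrite linearZr/= linearBl/= linear_sumlz.
(* The coefficient [g v (w i)] is the [i]-th entry of [r *m invmx G]. Pairing the sum with the
   [k]-th basis vector multiplies this row by [G], which returns entry [k] of [r]. *)
pose r := \row_(j < \dim Z) g v (vbasis Z)`_j.
have /rowP/(_ k) := mulmxKV uG r; rewrite !mxE => <-.
rewrite [X in _ - X](_ : _ = \sum_i (r *m invmx G) 0 i * G i k) ?subrr ?mulr0//.
apply: eq_bigr => i _; rewrite linearZl_LR !mxE linear_sumr; congr (_ * _).
by apply: eq_bigr => j _; rewrite linearZr/= mxE mulrC.
Qed.

Section PlotArithmetic.
Context {R : realType} {V : vectType R} {D : parametrizations R V}.
Hypothesis hV : is_diffeological_vector_space D.
Context {n : nat} {U : set 'rV[R]_n}.
Implicit Types p q : 'rV[R]_n -> V.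

Lemma plotD p q : D n U p -> D n U q -> D n U (fun x => p x + q x).
Proof. by move=> Dp Dq; apply: (dvs_add hV (p := fun x => (p x, q x))). Qed.

Lemma plotZ (c : 'rV[R]_n -> R) p :
  std_diff U c -> D n U p -> D n U (fun x => c x *: p x).
Proof. by move=> Dc Dp; apply: (dvs_scale hV (p := fun x => (c x, p x))). Qed.

Lemma plotN p : D n U p -> D n U (fun x => - p x).
Proof.
move=> Dp; have oU := plot_open (dvs_diffeology hV) Dp.
apply: (plot_ext (dvs_diffeology hV) (p := fun x => -1 *: p x)).
  by move=> x _; rewrite scaleN1r.
by apply: plotZ Dp; split=> // k; exact: Ck_cst.
Qed.

Lemma plot_sum (I : Type) (s : seq I) (p : I -> 'rV[R]_n -> V) :
  open U -> (forall i, D n U (p i)) -> D n U (fun x => \sum_(i <- s) p i x).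
Proof.
move=> oU Dp; have dD := dvs_diffeology hV; elim: s => [|i s IH].
  by apply: (plot_ext dD (p := fun=> 0)) => [x _|]; [rewrite big_nil|exact: (plot_cst dD)].
apply: (plot_ext dD (p := fun x => p i x + \sum_(j <- s) p j x)).
  by move=> x _; rewrite big_cons.
exact: plotD.
Qed.

Lemma plot_pairing (g : {symmetric V}) (w : V) p :
  smooth (prod_diff D D) (@std_diff R) (fun u => g u.1 u.2) ->
  D n U p -> std_diff U (fun x => g (p x) w).
Proof.
move=> sg Dp; apply: (sg _ _ (fun x => (p x, w))); split=> //.
exact: (plot_cst (dvs_diffeology hV) _ (plot_open (dvs_diffeology hV) Dp)).
Qed.

End PlotArithmetic.

(** Smoothness of [pi] makes the [V2]-component of a plot a plot; the [V1]-component is then a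
    difference of two plots. Conversely, sums of plots are plots. *)
Lemma smooth_decomposition_of_projection (R : realType) (V : vectType R)
    (D : parametrizations R V) (V1 V2 : {vspace V}) (pi : V -> V) :
  is_diffeological_vector_space D ->
  (V1 + V2)%VS = fullv -> directv (V1 + V2) ->
  smooth D D pi ->
  (forall v, pi v \in V2) -> (forall v, v - pi v \in V1) ->
  smooth_decomposition D V1 V2.
Proof.
move=> hV full direct spi pi2 pi1; have dD := dvs_diffeology hV.
split=> // n U p; split=> [Dp|[q [[Dq1 Dq2] pq]]]; last first.
  apply: (plot_ext dD (p := fun x => vsval (q x).1 + vsval (q x).2)).
    by move=> x /pq ->.
  exact: plotD.
exists (fun x => (Subvs (pi1 (p x)), Subvs (pi2 (p x)))); split.
  split; last exact: spi.
  by apply: (plotD hV _ (fun x => - pi (p x)) Dp); apply: (plotN hV); exact: spi.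
by move=> x _ /=; rewrite subrK.
Qed.

Theorem lemma2p7 (R : realType) (V : vectType R) (D : parametrizations R V)
    (hV : is_diffeological_vector_space D) (g : {symmetric V}%R)
    (hg : is_pseudo_metric D g) :
  splits_off_smoothly D (max_isotropic g).
Proof.
set V1 := max_isotropic g; set Z := (V1^C)%VS; exists Z.
have V1Z : (V1 + Z)%VS = fullv := addv_complf V1.
(* [V1] is orthogonal to everything and [V1 + Z] is all of [V], so being orthogonal to [Z] already
   means lying in the radical. *)
have orthZ v : v \in orthov g Z -> v \in V1.
  move=> vZ; apply/max_isotropicP => w.
  have /memv_addP[a /max_isotropicP aV1 [b bZ ->]] : w \in (V1 + Z)%VS.
    by rewrite V1Z memvf.
  by rewrite linearDr/= symmC aV1 add0r; apply: (mem_orthovP vZ).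
have [|w Hw] := @dual_basis_exists _ _ g Z.
  (* Nondegeneracy on [Z]: by [orthZ], the intersection lies in that of [V1] with its complement
     [Z]. *)
  apply/eqP; rewrite -subv0 -(capv_compl V1); apply: capvS => //.
  by apply/subvP => v /orthZ.
apply: (@smooth_decomposition_of_projection _ _ _ _ _
  (fun v => \sum_i g v (w i) *: (vbasis Z)`_i)) => //.
- by apply/directv_addP; exact: capv_compl.
- move=> n U p Dp; have oU := plot_open (dvs_diffeology hV) Dp.
  apply: (plot_sum hV) => // i; apply: (plotZ hV).
    exact: plot_pairing (pm_smooth hg) Dp.
  exact: (plot_cst (dvs_diffeology hV)).
- move=> v; apply: memv_suml => i _.
  by rewrite memvZ// vbasis_mem// mem_nth ?size_tuple.
- by move=> v; apply: orthZ; exact: Hw.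
Qed.
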